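(* There is a Borel measurable mapping $\Phi \colon \mathsf{LC}(Q) \to C(I,Q)$ such that for every $X \in \mathsf{LC}(Q)$, the image of $I$ under $\Phi(X)$ is equal to $X$.
   Context: $I = [0,1]$ and $Q = I^{\mathbb{N}}$ is the Hilbert cube (product topology). A continuum is a nonempty compact connected metrizable space; a Peano continuum is a locally connected continuum. $\mathcal{K}(Q)$ is the space of all nonempty compact subsets of $Q$ with the Vietoris topology (equivalently, the topology of the Hausdorff metric), and $\mathsf{LC}(Q) \subseteq \mathcal{K}(Q)$ is the subspace of all Peano continua contained in $Q$. $C(I,Q)$ is the space of all continuous mappings from $I$ to $Q$ with the topology of uniform convergence. A mapping between topological spaces is Borel measurable if preimages of open sets are Borel. *)

(* Defs.v *)
From HB Require Import structures.
From mathcomp Require Import all_boot all_order all_algebra.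
From mathcomp Require Import all_classical all_reals all_analysis.
Import Order.TTheory GRing.Theory Num.Theory.
Import numFieldNormedType.Exports.

Set Implicit Arguments.
Unset Strict Implicit.
Unset Printing Implicit Defensive.

Local Open Scope classical_set_scope.
Local Open Scope ring_scope.

Definition unit_interval (R : realType) : Type := set_type `[0 : R, 1]%classic.
HB.instance Definition _ (R : realType) := PseudoMetric.on (unit_interval R).

Definition hilbert_cube (R : realType) : Type :=
  {ptws nat -> unit_interval R}.
HB.instance Definition _ (R : realType) := PseudoMetric.on (hilbert_cube R).

Definition hyperspace (T : topologicalType) : Type :=
  set_type [set K : set T | K !=set0 /\ compact K].

Section Vietoris.
Variable T : topologicalType.

Definition hyperspace_set (K : hyperspace T) : set T := set_val K.

Definition vietoris_subbase : set (set (hyperspace T)) :=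
  [set [set K | hyperspace_set K `<=` U] | U in @open T] `|`
  [set [set K | hyperspace_set K `&` U !=set0] | U in @open T].

HB.instance Definition _ := Choice.on (hyperspace T).
HB.instance Definition _ :=
  isSubBaseTopological.Build (hyperspace T) vietoris_subbase id.

End Vietoris.

Definition metrizable (R : realType) (T : topologicalType) : Prop :=
  exists d : T -> T -> R,
    [/\ forall x, d x x = 0,
        forall x y, d x y = 0 -> x = y,
        forall x y, d x y = d y x,
        forall y x z, d x z <= d x y + d y z &
        forall x, nbhs x =
          filter_from [set e | 0 < e] (fun e => [set y | d x y < e])].

Definition continuum (R : realType) (T : topologicalType) : Prop :=
  [/\ [set: T] !=set0, compact [set: T], connected [set: T] & metrizable R T].

Definition locally_connected (T : topologicalType) : Prop :=
  forall (x : T) (U : set T), open_nbhs x U ->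
    exists V : set T, [/\ open_nbhs x V, connected V & V `<=` U].

Definition peano_continuum (R : realType) (T : topologicalType) : Prop :=
  continuum R T /\ locally_connected T.

(* [set_type] is applied twice: [LC R T] is a topological subspace of
   [hyperspace T], and each of its members [X] is turned into a space by the
   subspace topology that it inherits from [T]. *)
Definition LC (R : realType) (T : topologicalType) : Type :=
  set_type [set X : hyperspace T |
             peano_continuum R (set_type (hyperspace_set X))].
HB.instance Definition _ (R : realType) (T : topologicalType) :=
  Topological.on (LC R T).

Definition LC_set (R : realType) (T : topologicalType) (X : LC R T) : set T :=
  hyperspace_set (set_val X).

(* [continuousType] carries no default topology in the library. *)
Definition uniform_continuousType (S : topologicalType) (T : uniformType) :
  Type := continuousType S T.
HB.instance Definition _ (S : topologicalType) (T : uniformType) :=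
  Uniform.copy (uniform_continuousType S T)
    (initial_topology
      (fun f : continuousType S T => (f : S -> T) : {uniform S -> T})).

Definition borel_measurable (S T : topologicalType) (f : S -> T) : Prop :=
  forall U : set T, open U -> <<s @open S >> (f @^-1` U).

(* Main.v *)
Require Import Defs.
From mathcomp Require Import all_boot all_order all_algebra.
From mathcomp Require Import all_classical all_reals all_analysis.
From mathcomp Require Import lra zify.

(** This is a Borel version of the Hahn-Mazurkiewicz theorem: a Peano continuum
    [X] is a continuous image of the interval, and the parametrization is built
    from countably many discrete choices, each of which depends on [X] in a
    Borel way.

    Let [q] be a dense sequence of the cube. A finite list [s] of indices is a
    fine chain for [X] at scale [r] if its points [q i] are [r]-close to [X],
    consecutive ones are [r]-close to each other, and they are [r]-dense in
    [X]. Because [s] ranges over a countable set and the conditions are of the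
    form [X `<=` U] or [X `&` U !=set0] with [U] open, the set of [X] that have
    [s] as a fine chain is Borel for the Vietoris topology
    ([borel_fine_chain]). Connected subsets of [X], in contrast, never occur in
    a condition whose measurability is at stake: they are replaced by the
    existence of chains at every scale.

    A list [s'] follows [s] if it is obtained by replacing each entry of [s] by
    a block, of the same length for all entries, whose points are close to that
    entry. The list [s] is refinable at level [n] if it is a fine chain at scale
    [2 ^- n] which is followed, with tolerance [2 ^- n], by fine chains at every
    scale. The heart of the proof is that for a Peano continuum every
    sufficiently fine chain is refinable ([fine_chain_refines]). By compactness,
    local connectedness is uniform: close points of [X] lie in a small connected
    subset of [X] ([linked_uniformly]). Such a connected set can be toured by
    chains of arbitrarily small step ([connected_tour]), and the tours around
    the successive points of a chain are put end to end ([tour_blocks]). Hence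
    every refinable list is followed by a list refinable at the next level
    ([refinable_next]), namely by a sufficiently fine chain.

    Always taking the first admissible list in a fixed enumeration gives lists
    [s n X] with Borel fibres ([borel_dependent_choice]). The step functions
    that run through the lists [s n X] at constant speed converge uniformly,
    since each list follows the previous one with summable tolerances; since the
    steps tend to [0] the limit is continuous, and it maps the interval onto [X]
    because the chains become dense in [X] ([walk_limit]). Finally, the value of
    [Phi] at [X] belongs to an open set [U] exactly if for some [n] the list
    [s n X] already forces this, so the preimage of [U] is a countable union of
    fibres of the maps [s n]. *)

Import Order.TTheory GRing.Theory Num.Theory.
Import numFieldNormedType.Exports.

Set Implicit Arguments.
Unset Strict Implicit.
Unset Printing Implicit Defensive.

Local Open Scope classical_set_scope.

(** * Pseudometric preliminaries *)

Section Metric.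
Context {R : realType} {T : pseudoMetricType R}.
Local Open Scope ring_scope.

Definition tol (n : nat) : R := 2^-1 ^+ n.

Lemma tol_gt0 n : 0 < tol n.
Proof. by rewrite exprn_gt0 // invr_gt0. Qed.

Lemma tolS n : tol n = tol n.+1 + tol n.+1.
Proof. rewrite /tol exprS; lra. Qed.

Lemma tol_le m n : (m <= n)%N -> tol n <= tol m.
Proof.
move=> mn; by apply: ler_wiXn2l => //; rewrite ?invr_ge0 ?invf_le1 ?ler1n.
Qed.

Lemma tol_small (e : R) : 0 < e -> exists n, tol n <= e.
Proof.
move=> e0; have [n] := @ltr_add_invr R 0 e e0; rewrite add0r => ne.
exists n.+1; apply: le_trans (ltW ne).
rewrite /tol exprVn lef_pV2 ?posrE ?exprn_gt0 ?ltr0Sn //.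
by rewrite -natrX ler_nat ltnW // ltn_expl.
Qed.

Lemma ball_inside (x y : T) (a b : R) :
  a < b -> ball x a y -> (ball x b)° y.
Proof.
move=> ab xy; apply/nbhs_ballP; exists (b - a); first by rewrite /= subr_gt0.
by move=> z yz; rewrite -(subrKC a b); apply: ball_triangle xy yz.
Qed.

(** Collect finite nets for the radii [tol n]. They come from the near-covering
    form of compactness, applied to the filter of finite sequences directed by
    inclusion. *)
Lemma dense_sequence : compact [set: T] -> [set: T] !=set0 ->
  exists q : nat -> T, forall x (r : R), 0 < r -> exists u, ball x r (q u).
Proof.
move=> cT [x0 _].
have net n : exists s : seq T, forall x, exists2 y, y \in s & ball x (tol n) y.
  pose above (s : seq T) := [set s' : seq T | {subset s <= s'}].
  have FF : Filter (filter_from [set: seq T] above).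
    apply: filter_from_filter; first by exists [::].
    move=> s s' _ _; exists (s ++ s') => // t tP.
    by split=> y ys; apply: tP; rewrite mem_cat ys ?orbT.
  have [x _|s _ sP] := (compact_near_coveringP _).1 cT _ _
      (fun s x => exists2 y, y \in s & ball x (tol n) y) FF; last first.
    by exists s => x; exact: sP.
  exists (ball x (tol n), above [:: x]) => /=.
    by split; [exact/nbhsx_ballx/tol_gt0|exists [:: x]].
  case=> y s /= [xy xs]; exists x; last exact: ball_sym.
  by apply: xs; rewrite mem_head.
have [s sP] := choice net.
exists (fun m => if @unpickle (nat * nat)%type m is Some ab
                 then nth x0 (s ab.1) ab.2 else x0) => x r r0.
have [n nr] := tol_small r0; have [y ys xy] := sP n x.
exists (pickle (n, index y (s n))); rewrite pickleK /= nth_index //.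
exact: le_ball xy.
Qed.

(** A part of [W] that is stable under jumps of length [r] inside [W] is
    relatively open, and relatively closed since the jumps are symmetric. *)
Lemma connected_uniform (W A : set T) (r : R) : 0 < r -> connected W ->
  A `<=` W -> A !=set0 -> (forall x y, A x -> W y -> ball x r y -> A y) ->
  A = W.
Proof.
move=> r0 cW AW A0 AP; apply: cW => //.
  exists (\bigcup_(x in A) (ball x r)°).
    by apply: bigcup_open => x _; exact: open_interior.
  apply/seteqP; split=> [x Ax|x [Wx [y Ay yx]]].
    by split; [exact: AW|exists x => //; exact: nbhsx_ballx].
  exact: AP Ay Wx (interior_subset yx).
exists (closure A); first exact: closed_closure.
apply/seteqP; split=> [x Ax|x [Wx clx]].
  by split; [exact: AW|exact: subset_closure].
have [y [Ay xy]] := clx _ (nbhsx_ballx x r r0).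
exact: AP Ay Wx (ball_sym xy).
Qed.

End Metric.

(** * Chains touring connected sets *)

Section Chains.
Context {R : realType} {T : pseudoMetricType R} (q : nat -> T).
Local Open Scope ring_scope.
Hypothesis q_dense : forall x (r : R), 0 < r -> exists u, ball x r (q u).

(** The factor [3] is what the triangle inequality yields for indices that
    [r]-approximate two points of [W] at distance [r]. *)
Definition tour_step (W : set T) (r : R) : rel nat := fun u v =>
  `[< ball (q u) (3 * r) (q v) /\ exists2 w, W w & ball w r (q v) >].

Lemma tour_stepP (W : set T) (r : R) x y u v : W y -> ball x r (q u) ->
  ball y r (q v) -> ball x r y -> tour_step W r u v.
Proof.
move=> Wy xu yv xy; apply/asboolP; split; last by exists y.
have -> : 3 * r = r + r + r by lra.
by apply: ball_triangle yv; apply: ball_triangle xy; exact: ball_sym.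
Qed.

Lemma connected_chain (W : set T) (r : R) x y u v : connected W -> 0 < r ->
  W x -> W y -> ball x r (q u) -> ball y r (q v) ->
  exists2 p, path (tour_step W r) u p & last u p = v.
Proof.
move=> cW r0 Wx Wy xu yv.
pose A := [set z | W z /\
  exists p, path (tour_step W r) u p /\ ball z r (q (last u p))].
suff AW : A = W.
  have [_ [p [up yp]]] : A y by rewrite AW.
  exists (rcons p v); last by rewrite last_rcons.
  by rewrite rcons_path up; apply: tour_stepP Wy yp yv _; exact: ballxx.
apply: (connected_uniform r0 cW) => [z []//||z z' [Wz [p [up zp]]] Wz' zz'].
  by exists x; split=> //; exists [::].
split=> //; have [w z'w] := q_dense z' r0; exists (rcons p w).
by rewrite rcons_path last_rcons up; split=> //; exact: tour_stepP zp z'w zz'.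
Qed.

(** Besides joining [u] to [v], the chain makes a detour through every index of
    [F]; this is how the chains become dense in [X]. *)
Lemma connected_tour (W : set T) (r : R) x y u v (F : seq nat) :
  connected W -> 0 < r ->
  W x -> W y -> ball x r (q u) -> ball y r (q v) ->
  (forall a, a \in F -> exists2 w, W w & ball w r (q a)) ->
  exists p, [/\ path (tour_step W r) u p, last u p = v & {subset F <= u :: p}].
Proof.
move=> cW r0 Wx Wy xu yv; elim: F x u Wx xu => [|a F IH] x u Wx xu FW.
  by have [p] := connected_chain cW r0 Wx Wy xu yv; exists p.
have [w Ww wa] := FW a (mem_head _ _).
have [p1 up1 p1a] := connected_chain cW r0 Wx Ww xu wa.
have [|p2 [ap2 p2v Fp2]] := IH w a Ww wa.
  by move=> b bF; apply: FW; rewrite inE bF orbT.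
exists (p1 ++ p2); rewrite cat_path last_cat p1a up1 ap2 p2v; split=> // b.
have ap : a \in u :: p1 by rewrite -p1a mem_last.
rewrite -cat_cons mem_cat inE => /predU1P[->|/Fp2]; first by rewrite ap.
by rewrite inE => /predU1P[->|->]; rewrite ?ap ?orbT.
Qed.

(** The last index is the default value, so that a list behaves as an eventually
    constant sequence: conditions on vertices can be stated for all [i]. *)
Definition vertex (s : seq nat) (i : nat) : T := q (nth (last 0%N s) s i).

Lemma vertex_minn s i : vertex s i = vertex s (minn i (size s).-1).
Proof.
rewrite /vertex; congr q; have [ilt|ige] := ltnP i (size s).
  by congr nth; lia.
by rewrite (minn_idPr _) ?nth_last ?nth_default //; case: s ige => //= a s; lia.
Qed.

Lemma vertex_mkseq f n i : (i < n)%N -> vertex (mkseq f n) i = q (f i).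
Proof. by move=> ilt; rewrite /vertex nth_mkseq. Qed.

(** Interiors of balls are used because balls need not be open, and conditions
    on [X] have to be given by open sets. *)
Record fine_chain (r : R) (s : seq nat) (X : set T) : Prop := FineChain {
  chain_size : (0 < size s)%N;
  chain_near : forall i, X `&` (ball (vertex s i) r)° !=set0;
  chain_step : forall i, ball (vertex s i) r (vertex s i.+1);
  chain_dense : X `<=` \bigcup_i (ball (vertex s i) r)° }.

(** All blocks have the same length [M], so that running through [s] and [s'] at
    constant speed gives functions which are [r]-close. *)
Definition follows (r : R) (s s' : seq nat) : Prop :=
  exists M, [/\ (0 < M)%N, size s' = (size s * M)%N &
    forall i, ball (vertex s (i %/ M)%N) r (vertex s' i)].

Lemma step_nth (e : rel nat) u p v i : path e u p -> last u p = v ->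
  (i < size p)%N -> e (nth v (u :: p) i) (nth v (u :: p) i.+1).
Proof. by move=> /(pathP v) up _ /up. Qed.

(** The [j]-th block of [s] is a tour of [W j] from (an index near) [x j] to
    [x j.+1], passing near every point of a finite net that is close to [W j].
    Consecutive blocks fit together because the end of a tour is the start of
    the next one; tours that are shorter than [M] wait at their end. *)
Lemma tour_blocks (X : set T) (W : nat -> set T) (x : nat -> T) N (r : R) :
  compact [set: T] -> 0 < r -> (0 < N)%N ->
  (forall j, (j < N)%N ->
    [/\ connected (W j), W j `<=` X, W j (x j) & W j (x j.+1)]) ->
  X `<=` \bigcup_(j in [set j | (j < N)%N]) W j ->
  exists M s, [/\ (0 < M)%N, size s = (N * M)%N, fine_chain (4 * r) s X &
    forall i, (i < N * M)%N -> exists2 w, W (i %/ M)%N w & ball w r (vertex s i)].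
Proof.
move=> cT r0 N0 WP XW.
(* [F] is a finite [r]-net of the whole space. *)
have [F FP] : exists F : seq nat, forall y : T,
    exists2 u, u \in F & ball y r (q u).
  suff cover : forall y, [set: T] y -> \forall y' \near y & m \near \oo,
      exists2 u, (u < m)%N & ball y' r (q u).
    have [m _ mP] := (compact_near_coveringP _).1 cT nat \oo _ _ cover.
    exists (iota 0 m) => y; have [u um yu] := mP m (leqnn m) y I.
    by exists u => //; rewrite mem_iota.
  move=> y _.
  have [u yu] := q_dense y (divr_gt0 r0 (@ltr0Sn R 1)).
  exists (ball y (r / 2), [set m | (u < m)%N]) => /=.
    split; first by apply: nbhsx_ballx; rewrite divr_gt0.
    by exists u.+1.
  case=> z m /= [yz um]; exists u => //; rewrite (splitr r).
  by apply: ball_triangle yu; exact: ball_sym.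
have [u uP] := choice (fun j => q_dense (x j) r0).
have /choice[p pP] j : exists p, (j < N)%N ->
    [/\ path (tour_step (W j) r) (u j) p, last (u j) p = u j.+1 &
       forall a w, a \in F -> W j w -> ball w r (q a) -> a \in u j :: p].
  have [jN|jN] := ltnP j N; last by exists [::].
  have [cW _ Wx Wx'] := WP j jN.
  have [|p [up pv Fp]] := @connected_tour _ r _ _ _ _
      [seq a <- F | `[< exists2 w, W j w & ball w r (q a) >]]
      cW r0 Wx Wx' (uP j) (uP j.+1).
    by move=> a; rewrite mem_filter => /andP[/asboolP].
  exists p => _; split=> // a w aF Ww wa; apply: Fp.
  by rewrite mem_filter aF andbT; apply/asboolP; exists w.
(* A tour [u j :: p j] has [(size (p j)).+1] entries, hence the successor. *)
pose M := (\max_(j < N) size (p j)).+1.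
have pM j : (j < N)%N -> (size (p j) < M)%N.
  by move=> jN; rewrite ltnS (leq_bigmax (Ordinal jN)).
(* The default value of [nth] is the end of the tour: it pads the block. *)
pose B j i := nth (u j.+1) (u j :: p j) i.
pose z i := B (i %/ M)%N (i %% M)%N.
have BW j i : (j < N)%N -> exists2 w, W j w & ball w r (q (B j i)).
  move=> jN; have [up pv _] := pP j jN; have [_ _ Wx Wx'] := WP j jN.
  case: i => [|i]; first by exists (x j).
  rewrite /B /=; have [ip|ip] := ltnP i (size (p j)).
    by have /asboolP[_ [w Ww wq]] := step_nth up pv ip; exists w.
  by rewrite nth_default //; exists (x j.+1).
have Bstep j i : (j < N)%N -> ball (q (B j i)) (3 * r) (q (B j i.+1)).
  move=> jN; have [up pv _] := pP j jN; rewrite /B.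
  have [ip|ip] := ltnP i (size (p j)).
    by have /asboolP[] := step_nth up pv ip.
  rewrite [X in ball _ _ (q X)]nth_default //.
  suff -> : nth (u j.+1) (u j :: p j) i = u j.+1 by apply: ballxx; lra.
  have [->|ne] := eqVneq i (size (p j)).
    by rewrite -[in RHS]pv (last_nth (u j.+1)).
  by rewrite nth_default //= ltn_neqAle eq_sym ne.
have Blast j i : (j < N)%N -> (size (p j) <= i)%N -> B j i = u j.+1.
  move=> jN pi; have [_ pv _] := pP j jN; rewrite /B.
  have [->|ne] := eqVneq i (size (p j)).
    by rewrite -[RHS]pv (last_nth (u j.+1)).
  by rewrite nth_default //= ltn_neqAle eq_sym ne.
have divN i : (i < N * M)%N -> (i %/ M < N)%N by move=> iNM; rewrite ltn_divLR.
have zstep i : (i < N * M)%N -> ball (q (z i)) (3 * r) (q (z i.+1)).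
  move=> /divN jN; rewrite /z; have kM : (i %% M < M)%N by rewrite ltn_mod.
  have [kM'|kM'] := ltnP (i %% M).+1 M.
    have -> : (i.+1 %/ M = i %/ M)%N.
      by rewrite {1}(divn_eq i M) -addnS divnMDl // (divn_small kM') addn0.
    have -> : (i.+1 %% M = (i %% M).+1)%N.
      by rewrite {1}(divn_eq i M) -addnS modnMDl modn_small.
    exact: Bstep.
  have E : (i.+1 = (i %/ M).+1 * M)%N by rewrite {1}(divn_eq i M) mulSn; lia.
  have -> : (i.+1 %/ M = (i %/ M).+1)%N by rewrite E mulnK.
  have -> : (i.+1 %% M = 0)%N by rewrite E modnMl.
  rewrite Blast //; last by rewrite -ltnS; apply: leq_trans (pM _ jN) kM'.
  by rewrite /B /=; apply: ballxx; lra.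
have NM0 : (0 < N * M)%N by rewrite muln_gt0 N0.
pose s := mkseq z (N * M); have szs : size s = (N * M)%N by rewrite size_mkseq.
have sW i : (i < N * M)%N -> exists2 w, W (i %/ M)%N w & ball w r (vertex s i).
  by move=> iNM; rewrite vertex_mkseq //; apply: BW; exact: divN.
exists M, s; split=> //; split; first by rewrite szs.
- move=> i; rewrite vertex_minn szs; set k := minn _ _.
  have kNM : (k < N * M)%N by rewrite /k; lia.
  have [w Ww wk] := sW k kNM; exists w; split.
    by have [_ + _ _] := WP _ (divN _ kNM); apply.
  by apply: (@ball_inside _ _ _ _ r); [lra|exact: ball_sym].
- move=> i; have [iNM|iNM] := ltnP i.+1 (N * M).
    rewrite !vertex_mkseq //; last exact: ltnW.
    by apply: le_ball (zstep i (ltnW iNM)); lra.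
  rewrite (vertex_minn s i) (vertex_minn s i.+1) szs.
  have -> : minn i.+1 (N * M).-1 = minn i (N * M).-1 by lia.
  by apply: ballxx; lra.
- move=> y Xy; have [j /= jN Wy] := XW y Xy; have [a aF ya] := FP y.
  have [_ _ /(_ a y aF Wy ya) ap] := pP j jN.
  pose k := index a (u j :: p j).
  have kM : (k < M)%N by apply: leq_trans (pM j jN); rewrite ltnS -ltnS index_mem.
  have iNM : (j * M + k < N * M)%N.
    apply: leq_trans (_ : j.+1 * M <= _)%N; last by rewrite leq_mul2r jN orbT.
    by rewrite mulSn; lia.
  exists (j * M + k)%N => //; rewrite vertex_mkseq // /z.
  rewrite divnMDl // divn_small // addn0 modnMDl modn_small // /B nth_index //.
  by apply: (@ball_inside _ _ _ _ r); [lra|exact: ball_sym].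
Qed.

End Chains.

(** * Refining chains in Peano continua *)

Section Refine.
Context {R : realType} {T : pseudoMetricType R} (q : nat -> T).
Local Open Scope ring_scope.
Hypothesis q_dense : forall x (r : R), 0 < r -> exists u, ball x r (q u).
Hypothesis cT : compact [set: T].

Definition linked (X : set T) (e : R) (x y : T) :=
  exists V, [/\ connected V, V `<=` X `&` ball x e, V x & V y].

(** For [x'] near [x], a connected set joining [x] to [x'] and one joining [x] to
    [y] have a connected union; so a bound valid at [x] is valid, up to a factor
    [2], on a neighbourhood of [x], and compactness makes it uniform. *)
Lemma linked_uniformly (X : set T) (e : R) : compact X -> 0 < e ->
  (forall x e, X x -> 0 < e ->
    exists2 d, 0 < d & forall y, X y -> ball x d y -> linked X e x y) ->
  exists2 d : R, 0 < d &
    forall x y, X x -> X y -> ball x d y -> linked X e x y.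
Proof.
move=> cX e0 loc.
suff cover : forall x, X x -> \forall x' \near x & n \near \oo,
    X x' -> forall y, X y -> ball x' (tol n) y -> linked X e x' y.
  have [n _ nP] := (compact_near_coveringP _).1 cX nat \oo _ _ cover.
  exists (tol n); first exact: tol_gt0.
  by move=> x y Xx; exact: (nP n (leqnn n) x Xx Xx).
move=> x Xx; have [d d0 dP] := loc x (e / 2) Xx (divr_gt0 e0 (@ltr0Sn R 1)).
have d20 : 0 < d / 2 by lra.
have [n nd] := tol_small d20.
exists (ball x (d / 2), [set m | (n <= m)%N]) => /=.
  by split; [exact: nbhsx_ballx|exists n].
case=> x' m /= [xx' nm] Xx' y Xy x'y.
have xd : ball x d x' by apply: le_ball xx'; lra.
have yd : ball x d y.
  rewrite (splitr d); apply: ball_triangle xx' _.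
  by apply: le_ball x'y; apply: le_trans nd; exact: tol_le.
have [V [cV VX Vx Vx']] := dP x' Xx' xd.
have [V' [cV' VX' V'x V'y]] := dP y Xy yd.
exists (V `|` V'); split; [|move=> z VVz|by left|by right].
  by apply: connectedU => //; exists x.
have [Xz xz] : (X `&` ball x (e / 2)) z by case: VVz => [/VX|/VX'].
split=> //; rewrite (splitr e); apply: ball_triangle xz.
by apply: ball_sym; have [] := VX _ Vx'.
Qed.

Lemma fine_chain_le (X : set T) (r r' : R) s : r <= r' ->
  fine_chain q r s X -> fine_chain q r' s X.
Proof.
move=> rr' [s0 near step dense].
have sub x : (ball x r)° `<=` (ball x r')°.
  by apply: interiorS; exact: le_ball.
split=> // [i|i|x Xx].
- by have [x [Xx ix]] := near i; exists x; split=> //; exact: sub.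
- exact: le_ball (step i).
- by have [i _ ix] := dense x Xx; exists i => //; exact: sub.
Qed.

Lemma fine_chain_exists (X : set T) (r : R) : connected X -> X !=set0 -> 0 < r ->
  exists s, fine_chain q r s X.
Proof.
move=> cX [x Xx] r0.
have r40 : 0 < r / 4 by lra.
have [j _|y Xy|M [s [_ _ sX _]]] :=
  @tour_blocks _ _ _ q_dense X (fun=> X) (fun=> x) 1 (r / 4) cT r40 isT.
- by split.
- by exists 0%N.
exists s; suff <- : 4 * (r / 4) = r by [].
lra.
Qed.

(** Beyond their sizes both lists are constant, so that finitely many blocks are
    enough. *)
Lemma follows_blocks s s' M (r : R) : (0 < size s)%N -> (0 < M)%N ->
  size s' = (size s * M)%N ->
  (forall i, (i < size s * M)%N ->
    ball (vertex q s (i %/ M)%N) r (vertex q s' i)) ->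
  follows q r s s'.
Proof.
move=> s0 M0 sz sP; exists M; split=> // i.
have NM0 : (0 < size s * M)%N by rewrite muln_gt0 s0.
have [/sP//|iNM] := ltnP i (size s * M).
rewrite vertex_minn (vertex_minn q s' i) sz.
have -> : minn i (size s * M).-1 = (size s * M).-1 by lia.
have E : ((size s * M).-1 %/ M = (size s).-1)%N.
  have -> : ((size s * M).-1 = (size s).-1 * M + M.-1)%N by nia.
  by rewrite divnMDl // divn_small ?addn0 // prednK.
have -> : minn (i %/ M) (size s).-1 = ((size s * M).-1 %/ M)%N.
  rewrite E; apply/minn_idPr; rewrite -E; apply: leq_div2r; lia.
by apply: sP; lia.
Qed.

(** Take for [W j] the component of a point [x j] of [X], near the [j]-th vertex,
    in a small ball of [X]. If the chain [s] is fine enough, uniform local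
    connectedness puts into [W j] both [x j.+1] and all points of [X] close to
    the [j]-th vertex; so the [W j] cover [X] and are toured one after another
    by chains of any prescribed fineness. *)
Lemma fine_chain_refines (X : set T) (e : R) : 0 < e ->
  (forall e, 0 < e -> exists2 d : R, 0 < d &
    forall x y, X x -> X y -> ball x d y -> linked X e x y) ->
  exists2 d : R, 0 < d & forall r s, 0 < r -> r <= d -> fine_chain q r s X ->
    forall r', 0 < r' -> exists2 s', follows q e s s' & fine_chain q r' s' X.
Proof.
move=> e0 lX; have e30 : 0 < e / 3 by lra.
have [d d0 dP] := lX _ e30.
exists (Num.min (d / 3) (e / 3)); first by rewrite lt_min; lra.
move=> r s r0; rewrite le_min => /andP[rd re] sX h h0.
have [x xP] := choice (chain_near sX).
have Xx j : X (x j) by have [] := xP j.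
have sx j : ball (vertex q s j) r (x j).
  by have [_] := xP j; exact: interior_subset.
pose W j := connected_component (X `&` ball (x j) (e / 3)) (x j).
have Wmem j y : X y -> ball (x j) d y -> W j y.
  move=> Xy xy; have [V [cV VX Vx Vy]] := dP _ _ (Xx j) Xy xy.
  exact: (@connected_component_max _ _ V).
have WX j : W j `<=` X `&` ball (x j) (e / 3) by exact: connected_component_sub.
pose h' := Num.min (h / 4) (e / 3).
have h'0 : 0 < h' by rewrite lt_min; lra.
have [h'h h'e] : h' <= h / 4 /\ h' <= e / 3 by rewrite /h' !ge_min !lexx orbT.
have [j jN|y Xy|M [s' [M0 sz s'X s'W]]] :=
  @tour_blocks _ _ _ q_dense X W x (size s) h' cT h'0 (chain_size sX).
- split; [exact: component_connected|by move=> y /WX[]| |].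
    by apply: Wmem => //; exact: ballxx.
  apply: Wmem => //; apply: (@le_ball _ _ _ (r + r + r)); first lra.
  apply: ball_triangle (sx _); apply: ball_triangle (chain_step sX j).
  exact: ball_sym.
- have [j _ jy] := chain_dense sX Xy.
  rewrite vertex_minn in jy; exists (minn j (size s).-1) => /=.
    by have := chain_size sX; lia.
  apply: Wmem => //; apply: (@le_ball _ _ _ (r + r)); first lra.
  by apply: ball_triangle (interior_subset jy); exact: ball_sym.
exists s'; last by apply: fine_chain_le s'X; lra.
apply: (follows_blocks (chain_size sX) M0 sz) => i iNM.
have [w /WX[_ xw] wi] := s'W i iNM.
apply: (@le_ball _ _ _ (r + e / 3 + h')); first lra.
by apply: ball_triangle wi; apply: ball_triangle xw; exact: sx.
Qed.

(** The second condition mentions [X] only through fine chains at given scales,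
    which keeps it Borel in [X], and yet it guarantees that the construction can
    be continued. *)
Definition refinable n s (X : set T) := fine_chain q (tol n) s X /\
  forall k, exists2 s', follows q (tol n) s s' & fine_chain q (tol k) s' X.

(** Peano continua as subsets: local connectedness is replaced by its uniform
    form. *)
Definition peano_set (X : set T) := [/\ connected X, X !=set0 &
  forall e, 0 < e -> exists2 d : R, 0 < d &
    forall x y, X x -> X y -> ball x d y -> linked X e x y].

Lemma fine_chain_refinable X n : peano_set X ->
  exists m, forall s, fine_chain q (tol m) s X -> refinable n s X.
Proof.
case=> _ _ lX; have [d d0 dP] := fine_chain_refines (tol_gt0 n) lX.
have [m md] := tol_small d0; exists (maxn m n) => s sX; split.
  by apply: fine_chain_le sX; apply: tol_le; rewrite leq_maxr.
move=> k; apply: dP sX _ (tol_gt0 k); first exact: tol_gt0.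
by apply: le_trans md; apply: tol_le; rewrite leq_maxl.
Qed.

Lemma refinable_start X n : peano_set X -> exists s, refinable n s X.
Proof.
move=> pX; have [m mP] := fine_chain_refinable n pX.
have [cX X0 _] := pX; have [s sX] := fine_chain_exists cX X0 (tol_gt0 m).
by exists s; exact: mP.
Qed.

Lemma refinable_next X n s : peano_set X -> refinable n s X ->
  exists2 s', follows q (tol n) s s' & refinable n.+1 s' X.
Proof.
move=> pX [_ sX]; have [m mP] := fine_chain_refinable n.+1 pX.
by have [s' ss' s'X] := sX m; exists s' => //; exact: mP.
Qed.

(** * Step functions and their limit *)

(** The chain [s] run through at constant speed in unit time. *)
Definition walk (s : seq nat) (t : R) : T :=
  vertex q s (Num.truncn (t * (size s)%:R)).

Lemma walk_follows (r : R) s s' t : 0 <= t -> follows q r s s' ->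
  ball (walk s t) r (walk s' t).
Proof.
move=> t0 [M [M0 sz ss']]; rewrite /walk sz natrM mulrA.
set x := t * _; have x0 : 0 <= x by rewrite mulr_ge0.
suff -> : Num.truncn x = (Num.truncn (x * M%:R) %/ M)%N by [].
have MR : 0 < M%:R :> R by rewrite ltr0n.
have xM0 : 0 <= x * M%:R by rewrite mulr_ge0.
have /andP[lo hi] := Num.Theory.truncn_itv xM0.
apply/eqP; rewrite Num.Theory.truncn_eq //; apply/andP; split.
  rewrite -(ler_pM2r MR); apply: le_trans lo.
  by rewrite -natrM ler_nat leq_trunc_div.
rewrite -(ltr_pM2r MR); apply: lt_le_trans hi _.
by rewrite -natrM ler_nat ltn_ceil.
Qed.

(** Within the time spent at one vertex, a walk moves by at most one step. *)
Lemma walk_close X (r : R) s t t' : 0 <= t -> 0 <= t' -> 0 < r ->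
  fine_chain q r s X -> `|t - t'| * (size s)%:R < 1 ->
  ball (walk s t) r (walk s t').
Proof.
move=> + + r0 sX; wlog tt' : t t' / t <= t'.
  move=> H; have [/H//|/ltW tt'] := leP t t'.
  by rewrite distrC => t0 t'0 /(H _ _ tt' t'0 t0)/ball_sym.
move=> t0 t'0; rewrite distrC ger0_norm ?subr_ge0 // mulrBl /walk => lt1.
set x := t * _ in lt1 *; set x' := t' * _ in lt1 *.
have x0 : 0 <= x by rewrite mulr_ge0.
have xx' : x <= x' by rewrite ler_wpM2r.
have /andP[lo hi] := Num.Theory.truncn_itv x0.
have [->|] := eqVneq (Num.truncn x') (Num.truncn x); first exact: ballxx.
rewrite Num.Theory.truncn_eq ?(le_trans x0) // (le_trans lo) //= -leNgt => hi'.
suff /eqP -> : Num.truncn x' == (Num.truncn x).+1 by exact: chain_step sX _.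
rewrite Num.Theory.truncn_eq ?(le_trans x0) // hi' /=.
by rewrite -natr1; lra.
Qed.

(** A cluster point of the sequence does; the factor [3] leaves room for the sum
    [2 * tol n] of the later tolerances and for one approximation. *)
Lemma tail_limit (g : nat -> T) :
  (forall n, ball (g n) (tol n) (g n.+1)) ->
  exists y, forall n, ball (g n) (3 * tol n) y.
Proof.
move=> gS.
have far m n : ball (g n) (2 * tol n) (g (n + m)%N).
  elim: m n => [|m IH] n.
    by rewrite addn0; apply: ballxx; have := @tol_gt0 R n; lra.
  apply: (@le_ball _ _ _ (tol n + 2 * tol n.+1)); first by rewrite (tolS n); lra.
  by apply: ball_triangle (gS n) _; rewrite addnS -addSn.
have [y [_ yP]] := cT (fmap_proper_filter g eventually_filter) filterT.
exists y => n.
have [z [/= nz yz]] : ball (g n) (2 * tol n) `&` ball y (tol n) !=set0.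
  apply: yP; last exact/nbhsx_ballx/tol_gt0.
  by exists n => // m /= nm; rewrite -(subnKC nm); exact: far.
have -> : 3 * tol n = 2 * tol n + tol n :> R by lra.
by apply: ball_triangle nz _; exact: ball_sym.
Qed.

End Refine.

Lemma compact_set_type (X : topologicalType) (A : set X) :
  compact A -> compact [set: set_type A].
Proof.
move=> cA F PF _; have FA : (set_val @ F) A.
  by apply: (@filterS _ F _ setT) => [x _|]; [exact: set_valP|exact: filterT].
have [x [Ax xP]] := cA _ (fmap_proper_filter set_val PF) FA.
exists (exist _ x (mem_set Ax)); split=> // B C FB.
case=> _ [[E oE <-] /= Ex EC].
have [||_ [[y By <-] Ey]] := xP [set set_val (y : set_type A) | y in B] E.
- by apply: (@filterS _ F _ B) => // y By; exists y.
- exact: open_nbhs_nbhs.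
by exists y; split=> //; exact: EC.
Qed.

Section Limit.
Context {R : realType} {T : pseudoMetricType R} (q : nat -> T).
Local Open Scope ring_scope.
Hypothesis cT : compact [set: T].
Hypothesis hT : hausdorff_space T.

Lemma unit_interval_itv (t : unit_interval R) : 0 <= val t <= 1.
Proof. by have := set_valP t; rewrite /= in_itv. Qed.

Lemma unit_interval_compact : compact [set: unit_interval R].
Proof. by apply: compact_set_type; exact: segment_compact. Qed.

(** Passing to the limit costs [3 * tol n] on each side, and one step of the
    [n]-th chain costs [tol n]; hence the constants [7] for continuity and [4]
    for the two inclusions between the image and [X], both of which are
    closed. *)
Lemma walk_limit (X : set T) (s : nat -> seq nat) : compact X ->
  (forall n, fine_chain q (tol n) (s n) X) ->
  (forall n, follows q (tol n) (s n) (s n.+1)) ->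
  exists f : unit_interval R -> T, [/\ continuous f, f @` [set: _] = X &
    forall n t, ball (walk q (s n) (val t)) (3 * tol n) (f t)].
Proof.
move=> cX sX ss.
have t0 (t : unit_interval R) : 0 <= val t by have /andP[] := unit_interval_itv t.
have lim (t : unit_interval R) : exists y : T,
    forall n, ball (walk q (s n) (val t)) (3 * tol n) y.
  by apply: (tail_limit cT) => n; exact: walk_follows.
have [f fP] := choice lim.
have cf : continuous f.
  move=> t U /nbhs_ballP[e /= e0 eU].
  have [n ne] : exists n, tol n <= e / 7 by apply: tol_small; lra.
  have N0 : 0 < (size (s n))%:R :> R by rewrite ltr0n; exact: chain_size (sX n).
  apply/nbhs_ballP; exists (size (s n))%:R^-1; first by rewrite /= invr_gt0.
  move=> t' tt'; apply: eU.
  apply: (@le_ball _ _ _ (3 * tol n + tol n + 3 * tol n)); first lra.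
  apply: ball_triangle (fP t' n).
  apply: (@ball_triangle _ _ (walk q (s n) (val t))).
    exact/ball_sym.
  apply: walk_close (sX n) _ => //; first exact: tol_gt0.
  by rewrite -ltr_pdivlMr // div1r.
exists f; split=> //; apply/seteqP; split=> [_ [t _ <-]|x Xx].
  apply: (compact_closed hT cX) => B /nbhs_ballP[e /= e0 eB].
  have [n ne] : exists n, tol n <= e / 4 by apply: tol_small; lra.
  have [x [Xx /interior_subset wx]] := chain_near (sX n)
     (Num.truncn (val t * (size (s n))%:R)).
  exists x; split=> //; apply: eB.
  apply: (@le_ball _ _ _ (3 * tol n + tol n)); first lra.
  by apply: ball_triangle wx; exact/ball_sym/fP.
have cI : compact (f @` [set: unit_interval R]).
  apply: continuous_compact unit_interval_compact.
  exact: continuous_subspaceT.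
apply: (compact_closed hT cI) => B /nbhs_ballP[e /= e0 eB].
have [n ne] : exists n, tol n <= e / 4 by apply: tol_small; lra.
have [j _ /interior_subset jx] := chain_dense (sX n) Xx.
have N0 := chain_size (sX n).
have NR : 0 < (size (s n))%:R :> R by rewrite ltr0n.
pose k := minn j (size (s n)).-1.
have tI : (k%:R / (size (s n))%:R : R) \in `[0 : R, 1]%classic.
  rewrite inE /= in_itv /= divr_ge0 //= ler_pdivrMr // mul1r ler_nat /k; lia.
pose t : unit_interval R := @exist R (fun x => x \in `[0 : R, 1]%classic) _ tI.
exists (f t); split; first by exists t.
apply: eB; apply: (@le_ball _ _ _ (tol n + 3 * tol n)); first lra.
apply: ball_triangle (ball_sym jx) _.
have := fP t n; rewrite /walk /= divfK ?gt_eqF //.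
by rewrite Num.Theory.natrK -vertex_minn.
Qed.

End Limit.

(** * Borel sets and Borel choices *)

Section Borel.
Context {S : topologicalType}.

Notation borel P := (<<s @open S >> [set x | P x]).
Implicit Types P Q : S -> Prop.

Lemma borel_open (A : set S) : open A -> <<s @open S >> A.
Proof. exact: sub_sigma_algebra. Qed.

Lemma borel_not P : borel P -> borel (fun x => ~ P x).
Proof.
by move=> bP; have := sigma_algebraCD bP; rewrite setTD.
Qed.

Lemma borel_cst (p : Prop) : borel (fun=> p).
Proof.
have [pT|pF] := pselect p.
  suff -> : [set _ | p] = [set: S] by apply: borel_open; exact: openT.
  by apply/seteqP; split.
suff -> : [set _ | p] = set0 :> set S by exact: sigma_algebra0.
by apply/seteqP; split.
Qed.

Lemma borel_exists (I : countType) (P : I -> S -> Prop) :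
  (forall i, borel (P i)) -> borel (fun x => exists i, P i x).
Proof.
move=> bP.
have := @sigma_algebra_bigcup _ setT (@open S)
  (fun n => if @unpickle I n is Some i then [set x | P i x] else set0).
suff <- : [set x | exists i, P i x] = \bigcup_n
    (if @unpickle I n is Some i then [set x | P i x] else set0).
  apply=> n; case: unpickle => [i|]; [exact: bP|exact: sigma_algebra0].
apply/seteqP; split=> [x [i Pix]|x [n _]].
  by exists (pickle i) => //; rewrite pickleK.
by case: unpickle => [i Pix|//]; exists i.
Qed.

Lemma borel_forall (I : countType) (P : I -> S -> Prop) :
  (forall i, borel (P i)) -> borel (fun x => forall i, P i x).
Proof.
move=> bP.
suff -> : [set x | forall i, P i x] = [set x | ~ exists i, ~ P i x].
  by apply: borel_not; apply: borel_exists => i; exact: borel_not.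
apply/seteqP; split=> [x Px [i]|x Px i]; first exact.
by apply: contrapT => nP; apply: Px; exists i.
Qed.

Lemma borel_and P Q : borel P -> borel Q -> borel (fun x => P x /\ Q x).
Proof.
move=> bP bQ.
suff -> : [set x | P x /\ Q x] =
    [set x | forall b : bool, if b then P x else Q x].
  by apply: borel_forall => -[] /=.
apply/seteqP; split=> [x [Px Qx] []//|x PQ].
by split; [exact: (PQ true)|exact: (PQ false)].
Qed.

Lemma borel_or P Q : borel P -> borel Q -> borel (fun x => P x \/ Q x).
Proof.
move=> bP bQ.
suff -> : [set x | P x \/ Q x] =
    [set x | exists b : bool, if b then P x else Q x].
  by apply: borel_exists => -[] /=.
apply/seteqP; split=> [x [Px|Qx]|x [[] PQ]]; [by exists true|by exists false| |].
  by left.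
by right.
Qed.

(** The first admissible element in the enumeration of [I] is singled out by
    countably many Borel conditions. *)
Lemma borel_choice (I : countType) (P : I -> S -> Prop) :
  (forall i, borel (P i)) -> (forall x, exists i, P i x) ->
  exists f : S -> I, (forall x, P (f x) x) /\
    forall i, borel (fun x => f x = i).
Proof.
move=> bP exP.
pose least i x := P i x /\ forall j, (pickle j < pickle i)%N -> ~ P j x.
have ex_least x : exists i, least i x.
  have exn : exists n, `[< exists2 i, P i x & pickle i = n >].
    by have [i Pi] := exP x; exists (pickle i); apply/asboolP; exists i.
  have [n /asboolP[i Pi <-] imin] := ex_minnP exn.
  exists i; split=> // j; rewrite ltnNge => /negP ji Pj; apply: ji.
  by apply: imin; apply/asboolP; exists j.
have [f fP] := choice ex_least; exists f; split=> [x|i]; first by have [] := fP x.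
suff -> : [set x | f x = i] = [set x | least i x].
  apply: borel_and => //; apply: borel_forall => j.
  have [ji|ji] := ltnP (pickle j) (pickle i).
    suff -> : [set x | true -> ~ P j x] = [set x | ~ P j x] by exact: borel_not.
    by apply/seteqP; split=> [x /(_ isT)|x nP _].
  suff -> : [set x | false -> ~ P j x] = [set _ | True] by exact: borel_cst.
  by apply/seteqP; split.
apply/seteqP; split=> [x <-|x [Pi imin]]; first exact: fP.
have [Pf fmin] := fP x; apply: (@pcan_inj _ _ _ _ (@pickleK I)).
apply/eqP; rewrite eqn_leq; apply/andP.
by split; rewrite leqNgt; apply/negP => lt; [exact: fmin lt Pi|exact: imin lt Pf].
Qed.

Lemma borel_dependent_choice (I : countType) (P : nat -> I -> S -> Prop)
    (Q : nat -> I -> I -> Prop) :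
  (forall n i, borel (P n i)) -> (forall x, exists i, P 0 i x) ->
  (forall n i x, P n i x -> exists2 j, Q n i j & P n.+1 j x) ->
  exists f : nat -> S -> I, [/\ forall n x, P n (f n x) x,
    forall n x, Q n (f n x) (f n.+1 x) & forall n i, borel (fun x => f n x = i)].
Proof.
move=> bP ex0 exS.
have [f0 [f0P bf0]] := borel_choice (bP 0) ex0.
have next (ni : nat * I) : exists g : S -> I,
    (forall x, P ni.1 ni.2 x -> Q ni.1 ni.2 (g x) /\ P ni.1.+1 (g x) x) /\
    forall j, borel (fun x => g x = j).
  case: ni => n i /=.
  (* Where [P n i] fails every [j] is admitted, which makes the choice total. *)
  have [j|x|g [gP bg]] := @borel_choice I
      (fun j x => Q n i j /\ P n.+1 j x \/ ~ P n i x).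
  - apply: borel_or; last exact: borel_not.
    by apply: borel_and => //; exact: borel_cst.
  - have [/exS[j Qj Pj]|nP] := pselect (P n i x); last by exists i; right.
    by exists j; left.
  by exists g; split=> // x Px; have [|] := gP x.
have [g gP] := choice next.
pose f := fix f n := if n is n'.+1 then fun x => g (n', f n' x) x else f0.
have fP n x : P n (f n x) x.
  elim: n => [|n IH] /=; first exact: f0P.
  by have [_] := (gP (n, f n x)).1 x IH.
exists f; split=> // [n x|n].
  by have [] := (gP (n, f n x)).1 x (fP n x).
elim: n => [|n IH] i /=; first exact: bf0.
suff -> : [set x | g (n, f n x) x = i] =
    [set x | exists j, f n x = j /\ g (n, j) x = i].
  apply: borel_exists => j; apply: borel_and => //.
  by have [_] := gP (n, j); exact.
by apply/seteqP; split=> [x gi|x [j [<-]]//]; exists (f n x).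
Qed.

End Borel.

(** * The space of Peano continua *)

Section PeanoSets.
Context {R : realType} {T : pseudoMetricType R}.
Local Open Scope ring_scope.

Lemma image_set_val (A : set T) : [set set_val x | x in [set: set_type A]] = A.
Proof.
apply/seteqP; split=> [_ [x _ <-]|x Ax]; first exact: set_valP.
by exists (exist _ x (mem_set Ax)).
Qed.

Lemma connected_set_val (A : set T) (V : set (set_type A)) :
  connected V -> connected [set set_val x | x in V].
Proof.
move=> cV; apply: connected_continuous_connected => //.
apply: continuous_subspaceT; exact: initial_continuous.
Qed.

Lemma peano_setP (K : set T) : compact K ->
  peano_continuum R (set_type K) -> peano_set K.
Proof.
move=> cK [[K0 _ conK _] lcK]; split.
- by rewrite -(image_set_val K); exact: connected_set_val.
- by have [x _] := K0; exists (set_val x); exact: set_valP.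
move=> e e0; apply: linked_uniformly => // {e e0}x e Kx e0.
pose x' : set_type K := exist _ x (mem_set Kx).
have [|V [[oV Vx] cV VU]] := lcK x' (set_val @^-1` (ball x e)°).
  split; last exact: nbhsx_ballx.
  by exists (ball x e)° => //; exact: open_interior.
have [W oW WV] := oV.
have /nbhs_ballP[d /= d0 dW] : nbhs x W.
  by apply: open_nbhs_nbhs; split=> //; rewrite -WV in Vx.
exists d => // y Ky /dW Wy; pose y' : set_type K := exist _ y (mem_set Ky).
exists [set set_val z | z in V]; split.
- exact: connected_set_val.
- move=> _ [z /VU /interior_subset xz <-]; split=> //; exact: set_valP.
- by exists x'.
- by exists y' => //; rewrite -WV.
Qed.

Lemma LC_compact (X : LC R T) : compact (LC_set X).
Proof. by have [] := set_valP (set_val X). Qed.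

Lemma LC_peano_set (X : LC R T) : peano_set (LC_set X).
Proof. by have pX := set_valP X; apply: peano_setP pX; exact: LC_compact. Qed.

Lemma open_LC_subbase (A : set (hyperspace T)) : vietoris_subbase A ->
  open [set X : LC R T | A (set_val X)].
Proof.
move=> sA; exists A => //; exists [set A]; last by rewrite bigcup_set1.
move=> _ ->; exact: finI_from1.
Qed.

Lemma open_LC_meets (U : set T) : open U ->
  open [set X : LC R T | LC_set X `&` U !=set0].
Proof.
move=> oU; apply: (@open_LC_subbase [set K | hyperspace_set K `&` U !=set0]).
by right; exists U.
Qed.

Lemma open_LC_subset (U : set T) : open U ->
  open [set X : LC R T | LC_set X `<=` U].
Proof.
move=> oU; apply: (@open_LC_subbase [set K | hyperspace_set K `<=` U]).
by left; exists U.
Qed.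

Lemma borel_fine_chain (q : nat -> T) (r : R) s :
  <<s @open (LC R T) >> [set X | fine_chain q r s (LC_set X)].
Proof.
suff -> : [set X : LC R T | fine_chain q r s (LC_set X)] = [set X : LC R T |
    ((0 < size s)%N /\ forall i, ball (vertex q s i) r (vertex q s i.+1)) /\
    (LC_set X `<=` \bigcup_i (ball (vertex q s i) r)° /\
     forall i, LC_set X `&` (ball (vertex q s i) r)° !=set0)].
  apply: borel_and; first exact: borel_cst.
  apply: borel_and.
    apply: borel_open; apply: open_LC_subset.
    by apply: bigcup_open => i _; exact: open_interior.
  apply: borel_forall => i; apply: borel_open; apply: open_LC_meets.
  exact: open_interior.
by apply/seteqP; split=> [X []|X [[? ?] [? ?]]].
Qed.

Lemma borel_refinable (q : nat -> T) n s :
  <<s @open (LC R T) >> [set X | refinable q n s (LC_set X)].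
Proof.
apply: borel_and; first exact: borel_fine_chain.
apply: borel_forall => k.
suff -> : [set X : LC R T | exists2 s', follows q (tol n) s s' &
      fine_chain q (tol k) s' (LC_set X)] = [set X : LC R T | exists s',
    follows q (tol n) s s' /\ fine_chain q (tol k) s' (LC_set X)].
  apply: borel_exists => s'; apply: borel_and; first exact: borel_cst.
  exact: borel_fine_chain.
by apply/seteqP; split=> X [s']; [|case]; exists s'.
Qed.

Lemma open_uniform_continuous (S : topologicalType)
    (U : set (uniform_continuousType S T)) f : open U -> U f ->
  exists2 e : R, 0 < e & forall h : uniform_continuousType S T,
    (forall t, ball (f t) e (h t)) -> U h.
Proof.
case=> W oW <- Wf.
have /uniform_nbhs[E [entE EW]] : nbhs ((f : S -> T) : {uniform S -> T}) W.
  exact: open_nbhs_nbhs.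
move: entE; rewrite -entourage_ballE => -[e /= e0 eE].
by exists e => // h fh; apply: EW => t _; apply: eE; exact: fh.
Qed.

(** Of the cube, the construction uses only that it is a compact Hausdorff space
    with a pseudometric: this gives the dense sequence, the cluster points that
    serve as limits, and the closedness of compact sets. *)
Theorem borel_peano_parametrization : compact [set: T] -> hausdorff_space T ->
  [set: T] !=set0 ->
  exists Phi : LC R T -> uniform_continuousType (unit_interval R) T,
    borel_measurable Phi /\
    forall X : LC R T, Phi X @` [set: unit_interval R] = LC_set X.
Proof.
move=> cT hT T0; have [q q_dense] := dense_sequence cT T0.
have [n s|X|n s X|s [sP ss bs]] := @borel_dependent_choice (LC R T) (seq nat)
    (fun n s X => refinable q n s (LC_set X))
    (fun n s s' => follows q (tol n) s s').
- exact: borel_refinable.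
- by apply: refinable_start => //; exact: LC_peano_set.
- by apply: refinable_next => //; exact: LC_peano_set.
have lim (X : LC R T) : exists f : uniform_continuousType (unit_interval R) T,
    f @` [set: unit_interval R] = LC_set X /\
    forall n t, ball (walk q (s n X) (val t)) (3 * tol n) (f t).
  have [n|f [cf fX fs]] := walk_limit cT hT (@LC_compact X) _ (ss^~ X).
    by have [] := sP n X.
  by exists (mkcts cf).
have [Phi PhiP] := choice lim; exists Phi.
split=> [U oU|X]; last by case: (PhiP X).
(* The list [c] forces membership in [U] of every function that is as close to
   the walk along [c] as the limit is. *)
pose inside n c := forall h : uniform_continuousType (unit_interval R) T,
  (forall t, ball (walk q c (val t)) (3 * tol n) (h t)) -> U h.
suff -> : Phi @^-1` U = [set X | exists n, exists c, s n X = c /\ inside n c].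
  apply: borel_exists => n; apply: borel_exists => c.
  by apply: borel_and; [exact: bs|exact: borel_cst].
apply/seteqP; split=> [X UX|X [n [_ [<- sU]]]]; last first.
  by apply: sU; case: (PhiP X).
have [e e0 eU] := open_uniform_continuous oU UX.
have [n ne] : exists n, tol n <= e / 6 by apply: tol_small; lra.
exists n, (s n X); split=> // h hs; apply: eU => t.
apply: (@le_ball _ _ _ (3 * tol n + 3 * tol n)); first lra.
by apply: ball_triangle (hs t); apply: ball_sym; case: (PhiP X).
Qed.

End PeanoSets.

(** * The Hilbert cube *)

Lemma set_type_hausdorff (X : topologicalType) (A : set X) :
  hausdorff_space X -> hausdorff_space (set_type A).
Proof.
move=> hX x y xy; apply: val_inj; apply: hX => B C Bx Cy.
have [||z [Bz Cz]] := xy (set_val @^-1` B) (set_val @^-1` C).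
- exact: (@initial_continuous _ _ set_val x).
- exact: (@initial_continuous _ _ set_val y).
by exists (val z).
Qed.

Lemma hilbert_cube_hausdorff (R : realType) : hausdorff_space (hilbert_cube R).
Proof.
apply: (@hausdorff_product nat (fun=> unit_interval R)) => _.
apply: set_type_hausdorff; exact: Rhausdorff.
Qed.

Lemma hilbert_cube_compact (R : realType) : compact [set: hilbert_cube R].
Proof.
have := @tychonoff nat (fun=> unit_interval R) (fun=> setT)
  (fun=> unit_interval_compact).
by congr (compact _); apply/seteqP; split.
Qed.

Lemma hilbert_cube_nonempty (R : realType) : [set: hilbert_cube R] !=set0.
Proof.
have I0 : (0 : R)%R \in `[0%R : R, 1%R]%classic.
  by rewrite inE /= in_itv /= lexx ler01.
by exists (fun=> @exist R (fun x => x \in `[0%R : R, 1%R]%classic) _ I0).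
Qed.

Theorem theoremB (R : realType) :
  exists Phi : LC R (hilbert_cube R) ->
               uniform_continuousType (unit_interval R) (hilbert_cube R),
    borel_measurable Phi /\
    forall X : LC R (hilbert_cube R),
      Phi X @` [set: unit_interval R] = LC_set X.
Proof.
apply: borel_peano_parametrization.
- exact: hilbert_cube_compact.
- exact: hilbert_cube_hausdorff.
- exact: hilbert_cube_nonempty.
Qed.
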